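(* Let $K$ be an algebraically closed field of characteristic zero. The following statements are equivalent: (i) The Jacobian Conjecture holds in dimension 2 (over $K$), i.e. every $K$-algebra endomorphism $\alpha$ of $K[x,y]$ with $j(\alpha)\in K^{*}$ is an automorphism; (ii) All Lie subalgebras $L\subset \mathrm{Vec}^{c}(\mathbb{A}^2)$ isomorphic to $\mathfrak{aff}_2$ are conjugate under $\mathrm{Aut}(\mathbb{A}^2)$; (iii) All Lie subalgebras $L\subset \mathrm{Vec}^{c}(\mathbb{A}^2)$ isomorphic to $\mathfrak{saff}_2$ are conjugate under $\mathrm{Aut}(\mathbb{A}^2)$; (iv) All Lie subalgebras $L\subset \mathrm{Vec}^{c}(\mathbb{A}^2)$ isomorphic to $\mathfrak{aff}_2$ are algebraic; (v) All Lie subalgebras $L\subset \mathrm{Vec}^{c}(\mathbb{A}^2)$ isomorphic to $\mathfrak{saff}_2$ are algebraic.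
   Context: $\mathbb{A}^2=K^2$ is the affine plane. $\mathrm{Vec}(\mathbb{A}^2)=\{p\,\partial_x+q\,\partial_y \mid p,q\in K[x,y]\}=\mathrm{Der}_K(K[x,y])$ is the Lie algebra (under commutator) of polynomial vector fields. The divergence of $D=p\,\partial_x+q\,\partial_y$ is $\mathrm{div}\,D=p_x+q_y$, and $\mathrm{Vec}^{c}(\mathbb{A}^2)=\{D\mid \mathrm{div}\,D\in K\}$ is the Lie subalgebra of vector fields of constant divergence. For a $K$-algebra endomorphism $\alpha$ of $K[x,y]$ with $\alpha(x)=f$, $\alpha(y)=g$, put $j(\alpha)=f_xg_y-f_yg_x$. $\mathfrak{aff}_2$ is the Lie algebra of the group of affine transformations $v\mapsto Av+b$ ($A\in \mathrm{GL}_2(K)$, $b\in K^2$) of $\mathbb{A}^2$, identified with the Lie subalgebra $\langle \partial_x,\partial_y,x\partial_x+y\partial_y,x\partial_x-y\partial_y,x\partial_y,y\partial_x\rangle\subset \mathrm{Vec}^c(\mathbb{A}^2)$; $\mathfrak{saff}_2$ is the Lie algebra of the subgroup of affine transformations with $\det A=1$, identified with $\langle \partial_x,\partial_y,x\partial_x-y\partial_y,x\partial_y,y\partial_x\rangle$. ($\langle\cdots\rangle$ denotes $K$-linear span.) The group $\mathrm{Aut}(\mathbb{A}^2)$ of polynomial automorphisms of $\mathbb{A}^2$ (equivalently, of $K$-algebra automorphisms of $K[x,y]$) acts on vector fields by conjugation, $\alpha(D)=\alpha\circ D\circ\alpha^{-1}$ for $\alpha$ a $K$-algebra automorphism of $K[x,y]$.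 Two Lie subalgebras $L,L'$ are conjugate under $\mathrm{Aut}(\mathbb{A}^2)$ if $L'=\alpha(L)$ for some such $\alpha$. A Lie subalgebra $L\subset \mathrm{Vec}(\mathbb{A}^2)$ is called algebraic if it acts locally finitely on $\mathrm{Vec}(\mathbb{A}^2)$ (by the Lie bracket), i.e. every element of $\mathrm{Vec}(\mathbb{A}^2)$ is contained in a finite-dimensional $L$-stable subspace. *)

(* Defs.v *)
(* MathComp, with polynomials in two variables from multinomials. *)
From HB Require Import structures.
From mathcomp Require Import all_boot all_order all_algebra.
From mathcomp Require Import mpoly ring.

Set Implicit Arguments.
Unset Strict Implicit.
Unset Printing Implicit Defensive.

Import GRing.Theory.
Local Open Scope ring_scope.

Notation Pxy K := {mpoly K[2]}.
Notation ix := (@Ordinal 2 0 isT).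
Notation iy := (@Ordinal 2 1 isT).

(* The vector field p d/dx + q d/dy is the pair (p, q). *)
Notation Vec K := (Pxy K * Pxy K)%type.

Section VectorFields.

Variable K : fieldType.

Implicit Types (D E F : Vec K) (f g : Pxy K) (L M : Vec K -> Prop).

Definition polX : Pxy K := 'X_ix.
Definition polY : Pxy K := 'X_iy.

Definition vapp D f : Pxy K := D.1 * f^`M(ix) + D.2 * f^`M(iy).

(* The pair of values at x and y of the commutator of D and E; see lieE. *)
Definition lie D E : Vec K := (vapp D E.1 - vapp E D.1, vapp D E.2 - vapp E D.2).

Definition divergence D : Pxy K := D.1^`M(ix) + D.2^`M(iy).

Definition constant_divergence D := exists c : K, divergence D = c%:MP.

Definition lie_subalgebra L :=
  [/\ L 0, (forall (a : K) D E, L D -> L E -> L (a *: D + E)) &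
      (forall D E, L D -> L E -> L (lie D E))].

Definition span (s : seq (Vec K)) D :=
  exists c : 'I_(size s) -> K, D = \sum_(i < size s) c i *: s`_i.

Definition aff2 : Vec K -> Prop :=
  span [:: (1, 0); (0, 1); (polX, polY); (polX, - polY); (0, polX); (polY, 0)].

Definition saff2 : Vec K -> Prop :=
  span [:: (1, 0); (0, 1); (polX, - polY); (0, polX); (polY, 0)].

(* Only the restriction of phi to L matters. *)
Definition lie_isomorphic L M := exists phi : Vec K -> Vec K,
  [/\ (forall (a : K) D E, L D -> L E -> phi (a *: D + E) = a *: phi D + phi E),
      (forall D E, L D -> L E -> phi (lie D E) = lie (phi D) (phi E)),
      (forall D E, L D -> L E -> phi D = phi E -> D = E) &
      (forall E, M E <-> exists2 D, L D & phi D = E)].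

Definition jacobian (alpha : Pxy K -> Pxy K) : Pxy K :=
  let f := alpha polX in let g := alpha polY in
  f^`M(ix) * g^`M(iy) - f^`M(iy) * g^`M(ix).

Definition jacobian_conjecture2 :=
  forall alpha : {lrmorphism Pxy K -> Pxy K},
    (exists2 c : K, c != 0 & jacobian alpha = c%:MP) -> bijective alpha.

(* M = alpha(L) for some automorphism alpha with inverse beta, where
   alpha(D) is the vector field acting as alpha o D o beta; see
   conjugate_field for its existence. *)
Definition conjugate L M :=
  exists (alpha : {lrmorphism Pxy K -> Pxy K}) (beta : Pxy K -> Pxy K),
    [/\ cancel alpha beta, cancel beta alpha &
        forall E, M E <->
          exists2 D, L D & forall f, vapp E f = alpha (vapp D (beta f))].

Definition algebraic L :=
  forall D, exists2 s : seq (Vec K), span s D &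
    forall E F, L E -> span s F -> span s (lie E F).

Definition subalgebra_of_type (M L : Vec K -> Prop) :=
  [/\ lie_subalgebra L, (forall D, L D -> constant_divergence D) &
      lie_isomorphic L M].

Definition all_conjugate M :=
  forall L L', subalgebra_of_type M L -> subalgebra_of_type M L' ->
    conjugate L L'.

Definition all_algebraic M :=
  forall L, subalgebra_of_type M L -> algebraic L.

Lemma vappM D f g : vapp D (f * g) = vapp D f * g + f * vapp D g.
Proof.
rewrite /vapp !mderivM; ring.
Qed.

Lemma vapp_is_linear D : linear (vapp D).
Proof.
move=> c f g; rewrite /vapp !linearP /= !mulrDr -!scalerAr scalerDr.
by rewrite addrACA.
Qed.

Lemma vapp_polX D : vapp D polX = D.1.
Proof.
by rewrite /vapp !mderivX !mnmE /= scale1r scale0r mulr0 addr0 -[X in (X - _)%MM]add0m addmK mpolyX0 mulr1.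
Qed.

Lemma vapp_polY D : vapp D polY = D.2.
Proof.
by rewrite /vapp !mderivX !mnmE /= scale1r scale0r mulr0 add0r -[X in (X - _)%MM]add0m addmK mpolyX0 mulr1.
Qed.

Lemma vapp_unique D (d : Pxy K -> Pxy K) :
  linear d -> (forall f g, d (f * g) = d f * g + f * d g) ->
  d polX = D.1 -> d polY = D.2 -> d =1 vapp D.
Proof.
move=> dL dM dX dY.
pose h f := d f - vapp D f.
have hL c f g : h (c *: f + g) = c *: h f + h g.
  by rewrite /h dL vapp_is_linear scalerBr opprD addrACA.
have hM f g : h (f * g) = h f * g + f * h g.
  by rewrite /h dM vappM mulrBl mulrBr opprD addrACA.
have h1 : h 1 = 0.
  have := hM 1 1; rewrite !mulr1 mul1r => /(congr1 (fun u => u - h 1)).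
  by rewrite subrr addrK => <-.
have h0 : h 0 = 0.
  have := hL (-1) 0 0.
  by rewrite scaler0 addr0 scaleN1r addNr.
have hi (i : 'I_2) : h 'X_i = 0.
  case: i => [[|[|//]] lti].
  - have -> : 'X_(Ordinal lti) = polX :> Pxy K by congr ('X_[mnm1 _]); exact: val_inj.
    by rewrite /h vapp_polX dX subrr.
  - have -> : 'X_(Ordinal lti) = polY :> Pxy K by congr ('X_[mnm1 _]); exact: val_inj.
    by rewrite /h vapp_polY dY subrr.
have hX m : h 'X_[m] = 0.
  rewrite mpolyXE_id; elim/big_ind: _ => // [p q hp hq|i _].
    by rewrite hM hp hq mul0r mulr0 addr0.
  elim: (m i) => [|k IHk]; first by rewrite expr0.
  by rewrite exprS hM hi IHk mul0r mulr0 addr0.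
move=> f; apply/eqP; rewrite -subr_eq0 -/(h f); apply/eqP.
elim/mpolyind: f => // c m p _ _ hp.
by rewrite hL hX hp scaler0 addr0.
Qed.

Lemma lieE D E f : vapp (lie D E) f = vapp D (vapp E f) - vapp E (vapp D f).
Proof.
pose d f := vapp D (vapp E f) - vapp E (vapp D f).
symmetry; apply: (@vapp_unique _ d); rewrite /d.
- move=> c p q; rewrite !vapp_is_linear scalerBr opprD; exact: addrACA.
- have vD A p q : vapp A (p + q) = vapp A p + vapp A q.
    by rewrite -[p in LHS]scale1r vapp_is_linear scale1r.
  move=> p q; rewrite (vappM E p q) (vappM D p q).
  rewrite (vD D (vapp E p * q)) (vD E (vapp D p * q)).
  rewrite (vappM D (vapp E p) q) (vappM D p (vapp E q)).
  rewrite (vappM E (vapp D p) q) (vappM E p (vapp D q)).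
  ring.
- by rewrite !vapp_polX.
- by rewrite !vapp_polY.
Qed.

Lemma conjugate_field (alpha : {lrmorphism Pxy K -> Pxy K})
    (beta : Pxy K -> Pxy K) D :
  cancel alpha beta -> cancel beta alpha ->
  exists E, forall f, vapp E f = alpha (vapp D (beta f)).
Proof.
move=> aK bK; pose d f := alpha (vapp D (beta f)).
exists (d polX, d polY) => f; symmetry; apply: (@vapp_unique _ d) => //.
- move=> c p q; rewrite /d.
  have -> : beta (c *: p + q) = c *: beta p + beta q.
    apply: (can_inj aK); rewrite linearP [LHS]bK.
    by congr (c *: _ + _); rewrite [RHS]bK.
  by rewrite (vapp_is_linear D c (beta p) (beta q)) linearP.
- move=> p q; rewrite /d.
  have -> : beta (p * q) = beta p * beta q.
    apply: (can_inj aK); rewrite rmorphM [LHS]bK.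
    by congr (_ * _); rewrite [RHS]bK.
  rewrite vappM rmorphD !rmorphM; congr (_ * _ + _ * _); exact: bK.
Qed.

End VectorFields.

(* Main.v *)
From HB Require Import structures.
From mathcomp Require Import all_boot all_order all_algebra.
From mathcomp Require Import mpoly ring.
Require Import Defs.

Set Implicit Arguments.
Unset Strict Implicit.
Unset Printing Implicit Defensive.

Import GRing.Theory.
Local Open Scope ring_scope.

(** Write dx, dy for the two partial derivations.  A K-algebra endomorphism
    alpha with constant nonzero Jacobian is the comorphism of an etale
    self-map of the plane, so every vector field D lifts to a unique field
    [lift alpha D] with [lift alpha D o alpha = alpha o D].  Lifting is an
    injective homomorphism of Lie algebras and transforms divergence by alpha,
    hence maps saff2 and aff2 to isomorphic algebras of fields of constant
    divergence.  The converse, [affine_type_lift], is the core of the proof: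
    every algebra L of one of these types is the lift of the standard one along
    some such alpha.  Indeed, if u and v in L correspond to dx and dy, they are
    divergence free and commute, so their determinant is a constant.  It cannot
    vanish, because sl2 acts on the span of u and v ([cross_neq0]); potentials
    of u and v then give alpha with u = lift dx and v = lift dy, and the rest of
    L is forced, because only combinations of u and v commute with both.

    Let M be saff2 or aff2; the argument is the same for both.

    - If the Jacobian conjecture holds, the endomorphisms attached to two
      algebras of type M are automorphisms, and they provide the conjugation
      ([jacobian_conjugate]).

    - If all algebras of type M are conjugate, they are conjugate to M, which
      is algebraic since brackets with affine fields do not raise degrees;
      algebraicity is invariant under conjugation
      ([conjugate_all_algebraic]).

    - If all algebras of type M are algebraic, take any alpha with constant
      nonzero Jacobian; its lift of M is locally finite.  The lift h of
      x dx - y dy satisfies [h, u] = - u and [h, v] = v, which turns local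
      finiteness of u and v into local nilpotency ([locally_nilpotent]).
      Since u and v are dx and dy in the coordinates alpha(x) and alpha(y), a
      polynomial killed by powers of both is obtained by repeated integration
      from constants, so it lies in the image of alpha ([etale_surj]).  Thus
      alpha is bijective ([algebraic_jacobian]).

    Hence each of the four statements about subalgebras is equivalent to the
    Jacobian conjecture. *)

(** * Polynomials in two variables *)

Lemma polX_x (K : fieldType) : (polX K)^`M(ix) = 1.
Proof. by have := vapp_polX ((1, 0) : Vec K); rewrite /vapp mul1r mul0r addr0. Qed.

Lemma polX_y (K : fieldType) : (polX K)^`M(iy) = 0.
Proof. by have := vapp_polX ((0, 1) : Vec K); rewrite /vapp mul1r mul0r add0r. Qed.

Lemma polY_x (K : fieldType) : (polY K)^`M(ix) = 0.
Proof. by have := vapp_polY ((1, 0) : Vec K); rewrite /vapp mul1r mul0r addr0. Qed.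

Lemma polY_y (K : fieldType) : (polY K)^`M(iy) = 1.
Proof. by have := vapp_polY ((0, 1) : Vec K); rewrite /vapp mul1r mul0r add0r. Qed.

Lemma forall_ord2 (P : 'I_2 -> Prop) : P ix -> P iy -> forall i, P i.
Proof.
move=> Px Py [[|[|//]] lti].
- by rewrite (_ : Ordinal lti = ix) //; apply: val_inj.
- by rewrite (_ : Ordinal lti = iy) //; apply: val_inj.
Qed.

Lemma pol_ind (K : fieldType) (P : Pxy K -> Prop) :
    (forall c : K, P c%:MP) -> P (polX K) -> P (polY K) ->
    (forall p q, P p -> P q -> P (p + q)) ->
    (forall p q, P p -> P q -> P (p * q)) ->
  forall p, P p.
Proof.
move=> PC PX PY PD PM.
have Pm m : P 'X_[m].
  rewrite mpolyXE_id; elim/big_ind: _ => // [|i _]; first by rewrite -mpolyC1.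
  have Pi : P 'X_i by move: i; apply: forall_ord2.
  elim: (m i) => [|k IHk]; first by rewrite expr0 -mpolyC1.
  by rewrite exprS; apply: PM.
elim/mpolyind => [|c m p _ _ Pp]; first by rewrite -mpolyC0.
by apply: PD => //; rewrite -mul_mpolyC; apply: PM.
Qed.

Lemma natr_neq0 (K : fieldType) (n : nat) : has_char0 K -> n.+1%:R != 0 :> K.
Proof. by move/pcharf0P->. Qed.

Lemma msize_le_coef (K : fieldType) (p : Pxy K) (k : nat) :
  (forall m, (k <= mdeg m)%N -> p@_m = 0) -> (msize p <= k)%N.
Proof.
move=> p0; rewrite msizeE; apply/bigmax_leqP_seq => m m_p _.
by rewrite ltnNge; apply: contraL m_p => /p0; rewrite mcoeff_msupp => ->; rewrite eqxx.
Qed.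

Lemma msize_mderiv_le (K : fieldType) (i : 'I_2) (p : Pxy K) :
  (msize p^`M(i) <= (msize p).-1)%N.
Proof.
apply: msize_le_coef => m le_m; rewrite mcoeff_deriv memN_msupp_eq0 ?mul0rn //.
apply: msize_mdeg_ge; rewrite mdegD mdeg1 addn1.
by case: (msize p) le_m.
Qed.

Lemma mderiv_coef0 (K : fieldType) (i : 'I_2) (p : Pxy K) (m : 'X_{1..2}) :
  has_char0 K -> p^`M(i) = 0 -> m i != 0%N -> p@_m = 0.
Proof.
move=> charK0 dp0 mi0.
have le_im : (U_(i) <= m)%MM by rewrite lep1mP.
have := congr1 (mcoeff (m - U_(i))%MM) dp0.
rewrite mcoeff0 mcoeff_deriv submK // -mulr_natr => /eqP.
by rewrite mulf_eq0 (negbTE (natr_neq0 _ charK0)) orbF => /eqP.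
Qed.

Lemma mderiv_eq0 (K : fieldType) (p : Pxy K) :
  has_char0 K -> p^`M(ix) = 0 -> p^`M(iy) = 0 -> p = (p@_0)%:MP.
Proof.
move=> charK0 px0 py0; apply/mpolyP => m; rewrite mcoeffC.
have [->|m0] := eqVneq 0%MM m; first by rewrite mulr1.
rewrite mulr0.
have dp0 i : p^`M(i) = 0 by move: i; apply: forall_ord2.
have [i mi0] : exists i, m i != 0%N.
  apply/existsP; apply: contraR m0 => /existsPn m0; apply/eqP/mnmP => i.
  by rewrite mnm0E; move: (m0 i); rewrite negbK => /eqP.
exact: mderiv_coef0 (dp0 i) mi0.
Qed.

Definition antideriv (K : fieldType) (i : 'I_2) (p : Pxy K) : Pxy K :=
  \sum_(m <- msupp p) (p@_m / (m i).+1%:R) *: 'X_[m + U_(i)].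

Lemma antiderivK (K : fieldType) (i : 'I_2) (p : Pxy K) :
  has_char0 K -> (antideriv i p)^`M(i) = p.
Proof.
move=> charK0; rewrite [RHS]mpolyE raddf_sum; apply: eq_bigr => m _ /=.
rewrite mderivZ mderivX mnmDE mnm1E eqxx addn1 addmK scalerA.
by rewrite divfK ?natr_neq0.
Qed.

(** Without constants of integration, the only variable that integration can
    introduce is the variable of integration. *)
Lemma mderiv_antideriv (K : fieldType) (i j : 'I_2) (p : Pxy K) :
  has_char0 K -> i != j -> p^`M(j) = 0 -> (antideriv i p)^`M(j) = 0.
Proof.
move=> charK0 neq_ij dp0; rewrite raddf_sum big1_seq // => m /= m_p.
rewrite mderivZ mderivX mnmDE mnm1E (negbTE neq_ij) addn0.
have [->|mj0] := eqVneq (m j) 0%N; first by rewrite scale0r scaler0.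
by move: m_p; rewrite mcoeff_msupp (mderiv_coef0 charK0 dp0 mj0) eqxx.
Qed.

(** Integrate p in x and correct by a function of y alone; closedness says that
    the correction does not depend on x. *)
Lemma poincare (K : fieldType) (p q : Pxy K) :
  has_char0 K -> p^`M(iy) = q^`M(ix) -> exists f, f^`M(ix) = p /\ f^`M(iy) = q.
Proof.
move=> charK0 closed; pose g := antideriv ix p.
exists (g + antideriv iy (q - g^`M(iy))); rewrite !mderivD antiderivK //.
rewrite antiderivK // mderiv_antideriv //; first by rewrite addr0 addrC subrK.
by rewrite mderivB mderiv_comm antiderivK // closed subrr.
Qed.

Lemma lrmorphC (K : fieldType) (alpha : {lrmorphism Pxy K -> Pxy K}) (c : K) :
  alpha c%:MP = c%:MP.
Proof.
by rewrite -[in LHS](mulr1 c%:MP) mul_mpolyC linearZ rmorph1 /= -mul_mpolyC mulr1.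
Qed.

Lemma vappD (K : fieldType) (E : Vec K) (p q : Pxy K) :
  vapp E (p + q) = vapp E p + vapp E q.
Proof. by rewrite -[p in LHS]scale1r vapp_is_linear scale1r. Qed.

Lemma chain_rule (K : fieldType) (alpha : {lrmorphism Pxy K -> Pxy K})
    (E : Vec K) (p : Pxy K) :
  vapp E (alpha p) = alpha p^`M(ix) * vapp E (alpha (polX K))
                   + alpha p^`M(iy) * vapp E (alpha (polY K)).
Proof.
elim/pol_ind: p => [c|||p q IHp IHq|p q IHp IHq].
- by rewrite lrmorphC !mderivC rmorph0 !mul0r addr0 /vapp !mderivC !mulr0 addr0.
- by rewrite polX_x polX_y rmorph1 rmorph0 mul0r mul1r addr0.
- by rewrite polY_x polY_y rmorph1 rmorph0 mul0r mul1r add0r.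
- by rewrite !mderivD !rmorphD vappD IHp IHq; ring.
- by rewrite !mderivM !rmorphD !rmorphM vappM IHp IHq; ring.
Qed.

Lemma exists_endomorphism (K : fieldType) (f g : Pxy K) :
  exists alpha : {lrmorphism Pxy K -> Pxy K},
    alpha (polX K) = f /\ alpha (polY K) = g.
Proof.
exists (comp_mpoly [tuple f; g] : {lrmorphism Pxy K -> Pxy K}).
by rewrite /= !comp_mpolyXU.
Qed.

Lemma lrmorphism_inverse (K : fieldType)
    (alpha : {lrmorphism Pxy K -> Pxy K}) (b : Pxy K -> Pxy K) :
    cancel alpha b -> cancel b alpha ->
  exists beta : {lrmorphism Pxy K -> Pxy K}, beta =1 b.
Proof.
move=> aK bK.
pose bL := GRing.isLinear.Build _ _ _ _ b (can2_linear aK bK).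
pose bM := GRing.isMonoidMorphism.Build _ _ b (can2_monoid_morphism aK bK).
by exists (HB.pack_for {lrmorphism Pxy K -> Pxy K} b bL bM).
Qed.

(** Equality is decidable on choice types, so the inverse function needs no
    axiom. *)
Lemma bijective_choice (T U : choiceType) (f : T -> U) :
  injective f -> (forall y, exists x, f x = y) -> bijective f.
Proof.
move=> f_inj f_surj.
have ex y : exists x, f x == y by have [x <-] := f_surj y; exists x.
have gK : cancel (fun y => xchoose (ex y)) f.
  by move=> y; apply/eqP/(xchooseP (ex y)).
by exists (fun y => xchoose (ex y)) => // x; apply: f_inj; rewrite gK.
Qed.

(** * Vector fields *)

Lemma vapp_linearl (K : fieldType) (a : K) (D E : Vec K) (f : Pxy K) :
  vapp (a *: D + E) f = a *: vapp D f + vapp E f.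
Proof. by rewrite /vapp /= !mulrDl -!scalerAl scalerDr addrACA. Qed.

Lemma vappZl (K : fieldType) (a : K) (D : Vec K) (f : Pxy K) :
  vapp (a *: D) f = a *: vapp D f.
Proof. by rewrite /vapp /= -!scalerAl scalerDr. Qed.

Lemma vappDl (K : fieldType) (D E : Vec K) (f : Pxy K) :
  vapp (D + E) f = vapp D f + vapp E f.
Proof. by rewrite -[D in LHS]scale1r vapp_linearl scale1r. Qed.

Lemma vappB (K : fieldType) (D : Vec K) (p q : Pxy K) :
  vapp D (p - q) = vapp D p - vapp D q.
Proof. by rewrite -scaleN1r addrC vapp_is_linear scaleN1r addrC. Qed.

Lemma vapp0 (K : fieldType) (D : Vec K) : vapp D 0 = 0.
Proof. by rewrite /vapp !mderiv0 !mulr0 addr0. Qed.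

Lemma vappC (K : fieldType) (D : Vec K) (c : K) : vapp D c%:MP = 0.
Proof. by rewrite /vapp !mderivC !mulr0 addr0. Qed.

Lemma eq_field (K : fieldType) (D E : Vec K) : vapp D =1 vapp E -> D = E.
Proof.
by case: D E => [D1 D2] [E1 E2] eqDE; congr pair;
  [move: (eqDE (polX K)) | move: (eqDE (polY K))]; rewrite ?vapp_polX ?vapp_polY.
Qed.

Lemma lie_is_linear (K : fieldType) (D : Vec K) : linear (lie D).
Proof.
move=> a E F; apply: eq_field => f.
rewrite !(lieE, vapp_linearl, vapp_is_linear) scalerBr opprD.
exact: addrACA.
Qed.

HB.instance Definition _ (K : fieldType) (D : Vec K) :=
  GRing.isLinear.Build K (Vec K) (Vec K) _ (lie D) (lie_is_linear D).

Lemma lieC (K : fieldType) (D E : Vec K) : lie D E = - lie E D.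
Proof. by apply: eq_field => f; rewrite -scaleN1r vappZl !lieE scaleN1r opprB. Qed.

Lemma lie_linearl (K : fieldType) (a : K) (D E F : Vec K) :
  lie (a *: D + E) F = a *: lie D F + lie E F.
Proof.
by rewrite lieC linearP /= (lieC F D) (lieC F E) scalerN -opprD opprK.
Qed.

(** The determinant of the two fields. *)
Definition cross (K : fieldType) (D E : Vec K) : Pxy K := D.1 * E.2 - D.2 * E.1.

Lemma divergence_lie (K : fieldType) (D E : Vec K) :
  divergence (lie D E) = vapp D (divergence E) - vapp E (divergence D).
Proof.
rewrite /divergence /lie /vapp /= !(mderivD, mderivN, mderivM).
rewrite !(mderiv_comm ix iy); ring.
Qed.

Lemma divergence_lie0 (K : fieldType) (D E : Vec K) :
  constant_divergence D -> constant_divergence E -> divergence (lie D E) = 0.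
Proof. by move=> [c Dc] [e De]; rewrite divergence_lie Dc De !vappC subrr. Qed.

(** The Lie derivative of the area form along H is its divergence times the
    form. *)
Lemma vapp_cross (K : fieldType) (H D E : Vec K) :
  vapp H (cross D E)
  = cross (lie H D) E + cross D (lie H E) + divergence H * cross D E.
Proof.
rewrite /divergence /lie /cross /vapp /= !(mderivD, mderivN, mderivM); ring.
Qed.

(** The bracket of two divergence-free fields is the Hamiltonian field of their
    determinant. *)
Lemma lie_hamiltonian (K : fieldType) (D E : Vec K) :
    divergence D = 0 -> divergence E = 0 ->
  lie D E = (- (cross D E)^`M(iy), (cross D E)^`M(ix)).
Proof.
case: D E => [D1 D2] [E1 E2]; rewrite /divergence /= => /eqP + /eqP.
rewrite !addr_eq0 => /eqP D1x /eqP E1x.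
rewrite /lie /cross /vapp /= !mderivB !mderivM D1x E1x; congr pair; ring.
Qed.

Lemma commuting_const_cross (K : fieldType) (D E : Vec K) :
    has_char0 K -> divergence D = 0 -> divergence E = 0 -> lie D E = 0 ->
  cross D E = ((cross D E)@_0)%:MP.
Proof.
move=> charK0 divD divE; rewrite lie_hamiltonian // => DE0.
apply: mderiv_eq0 => //; first exact: (congr1 snd DE0).
by apply: oppr_inj; rewrite oppr0; exact: (congr1 fst DE0).
Qed.

(** Parallelism to a nonzero field is transitive, as it is over the field of
    rational functions. *)
Lemma cross_trans (K : fieldType) (D E F : Vec K) :
  E != 0 -> cross D E = 0 -> cross E F = 0 -> cross D F = 0.
Proof.
rewrite /cross => E0 /eqP + /eqP; rewrite !subr_eq0 => /eqP DE /eqP EF.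
have E1 : E.1 * (D.1 * F.2 - D.2 * F.1) = 0.
  transitivity (D.1 * (E.1 * F.2) - D.2 * E.1 * F.1); first by ring.
  by rewrite EF -DE; ring.
have E2 : E.2 * (D.1 * F.2 - D.2 * F.1) = 0.
  transitivity (D.1 * E.2 * F.2 - D.2 * (E.2 * F.1)); first by ring.
  by rewrite -EF DE; ring.
have [z1|nz1] := eqVneq E.1 0; last first.
  by apply: (mulfI nz1); rewrite E1 mulr0.
have nz2 : E.2 != 0 by apply: contraNneq E0 => z2; rewrite [E]surjective_pairing z1 z2.
by apply: (mulfI nz2); rewrite E2 mulr0.
Qed.

(** Cramer's rule: two independent fields killing f kill both partial
    derivatives of f. *)
Lemma cross_vapp (K : fieldType) (D E : Vec K) (f : Pxy K) :
    cross D E != 0 -> vapp D f = 0 -> vapp E f = 0 ->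
  f^`M(ix) = 0 /\ f^`M(iy) = 0.
Proof.
move=> nz; rewrite /vapp => Df Ef; split; apply: (mulfI nz); rewrite mulr0.
  rewrite (_ : _ * _ = E.2 * (D.1 * f^`M(ix) + D.2 * f^`M(iy))
                     - D.2 * (E.1 * f^`M(ix) + E.2 * f^`M(iy))); last first.
    rewrite /cross; ring.
  by rewrite Df Ef !mulr0 subrr.
rewrite (_ : _ * _ = D.1 * (E.1 * f^`M(ix) + E.2 * f^`M(iy))
                   - E.1 * (D.1 * f^`M(ix) + D.2 * f^`M(iy))); last first.
  rewrite /cross; ring.
by rewrite Df Ef !mulr0 subrr.
Qed.

(** * Lifting vector fields along an etale endomorphism *)

Definition etale (K : fieldType) (alpha : Pxy K -> Pxy K) :=
  exists2 c : K, c != 0 & jacobian alpha = c%:MP.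

(** This is Cramer's solution of the equations E(f) = alpha(D(x)),
    E(g) = alpha(D(y)) for a field E, where f and g are the images of x and y.
    For an etale alpha the constant coefficient of the Jacobian is the Jacobian
    itself. *)
Definition lift (K : fieldType) (alpha : Pxy K -> Pxy K) (D : Vec K) : Vec K :=
  let f := alpha (polX K) in let g := alpha (polY K) in
  ((jacobian alpha)@_0)^-1 *:
    ((alpha D.1 * g^`M(iy) - alpha D.2 * f^`M(iy),
      alpha D.2 * f^`M(ix) - alpha D.1 * g^`M(ix)) : Vec K).

Lemma etale_jacobian (K : fieldType) (alpha : Pxy K -> Pxy K) (p : Pxy K) :
  etale alpha -> ((jacobian alpha)@_0)^-1 *: (p * jacobian alpha) = p.
Proof.
case=> c c0 ->; rewrite mcoeffC eqxx mulr1 [p * _]mulrC mul_mpolyC scalerA.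
by rewrite mulVf // scale1r.
Qed.

Lemma vapp_lift (K : fieldType) (alpha : {lrmorphism Pxy K -> Pxy K})
    (D : Vec K) (p : Pxy K) :
  etale alpha -> vapp (lift alpha D) (alpha p) = alpha (vapp D p).
Proof.
move=> et_a; rewrite chain_rule.
have -> : vapp (lift alpha D) (alpha (polX K)) = alpha D.1.
  rewrite -[RHS](etale_jacobian _ et_a) vappZl; congr (_ *: _).
  rewrite /vapp /jacobian /=; ring.
have -> : vapp (lift alpha D) (alpha (polY K)) = alpha D.2.
  rewrite -[RHS](etale_jacobian _ et_a) vappZl; congr (_ *: _).
  rewrite /vapp /jacobian /=; ring.
by rewrite /vapp rmorphD !rmorphM [in RHS]addrC [in RHS]addrC; congr (_ + _); rewrite mulrC.
Qed.

Lemma etale_field_inj (K : fieldType) (alpha : Pxy K -> Pxy K) (D E : Vec K) :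
    etale alpha -> (forall p, vapp D (alpha p) = vapp E (alpha p)) -> D = E.
Proof.
move=> [c c0 jac] DE; pose f := alpha (polX K); pose g := alpha (polY K).
have nzj : jacobian alpha != 0 by rewrite jac mpolyC_eq0.
have D1 F : jacobian alpha * F.1 = g^`M(iy) * vapp F f - f^`M(iy) * vapp F g.
  rewrite /jacobian /vapp -/f -/g; ring.
have D2 F : jacobian alpha * F.2 = f^`M(ix) * vapp F g - g^`M(ix) * vapp F f.
  rewrite /jacobian /vapp -/f -/g; ring.
rewrite [D]surjective_pairing [E]surjective_pairing.
by congr pair; apply: (mulfI nzj); rewrite ?D1 ?D2 /f /g !DE.
Qed.

Lemma lift_is_linear (K : fieldType) (alpha : {lrmorphism Pxy K -> Pxy K})
    (a : K) (D E : Vec K) :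
  etale alpha -> lift alpha (a *: D + E) = a *: lift alpha D + lift alpha E.
Proof.
move=> et_a; apply: (etale_field_inj et_a) => p.
by rewrite !(vapp_linearl, vapp_lift) // linearP.
Qed.

Lemma lift0 (K : fieldType) (alpha : {lrmorphism Pxy K -> Pxy K}) :
  lift alpha 0 = 0.
Proof. by rewrite /lift /= rmorph0 !mul0r subrr -[(0, 0)]/(0 : Vec K) scaler0. Qed.

Lemma liftZ (K : fieldType) (alpha : {lrmorphism Pxy K -> Pxy K})
    (a : K) (D : Vec K) :
  etale alpha -> lift alpha (a *: D) = a *: lift alpha D.
Proof.
by move=> et_a; rewrite -[a *: D]addr0 lift_is_linear // lift0 addr0.
Qed.

Lemma lift_lie (K : fieldType) (alpha : {lrmorphism Pxy K -> Pxy K})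
    (D E : Vec K) :
  etale alpha -> lift alpha (lie D E) = lie (lift alpha D) (lift alpha E).
Proof.
move=> et_a; apply: (etale_field_inj et_a) => p.
by rewrite !(lieE, vapp_lift) // rmorphB.
Qed.

Lemma divergence_lift (K : fieldType) (alpha : {lrmorphism Pxy K -> Pxy K})
    (D : Vec K) :
  etale alpha -> divergence (lift alpha D) = alpha (divergence D).
Proof.
move=> et_a; rewrite -[RHS](etale_jacobian _ et_a) /divergence /lift /=.
rewrite !mderivZ -scalerDr; congr (_ *: _).
have dx p : (alpha p)^`M(ix) = vapp (1, 0) (alpha p).
  by rewrite /vapp mul1r mul0r addr0.
have dy p : (alpha p)^`M(iy) = vapp (0, 1) (alpha p).
  by rewrite /vapp mul1r mul0r add0r.
rewrite !mderivB !mderivM (dx D.1) (dx D.2) (dy D.1) (dy D.2).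
rewrite !(chain_rule _ _ D.1) !(chain_rule _ _ D.2) -!dx -!dy.
rewrite (mderiv_comm iy ix) (mderiv_comm iy ix) rmorphD /jacobian; ring.
Qed.

Lemma lift_unit_cross (K : fieldType) (alpha : {lrmorphism Pxy K -> Pxy K}) :
  etale alpha -> cross (lift alpha (1, 0)) (lift alpha (0, 1)) != 0.
Proof.
move=> et_a; have [c c0 jac] := et_a.
have j0 : jacobian alpha != 0 by rewrite jac mpolyC_eq0.
suff -> : cross (lift alpha (1, 0)) (lift alpha (0, 1))
          = ((jacobian alpha)@_0)^-1 *: ((((jacobian alpha)@_0)^-1)%:MP * jacobian alpha).
  by rewrite (etale_jacobian _ et_a) mpolyC_eq0 invr_eq0 jac mcoeffC eqxx mulr1.
rewrite /cross /lift /= !rmorph0 !rmorph1 !mul0r !mul1r !subr0 !sub0r.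
rewrite -!mul_mpolyC /jacobian; ring.
Qed.

(** The kernel is stable under dx and dy, since alpha intertwines them with
    their lifts; so a nonzero element of the kernel of minimal degree would be a
    constant. *)
Lemma etale_inj (K : fieldType) (alpha : {lrmorphism Pxy K -> Pxy K}) :
  has_char0 K -> etale alpha -> injective alpha.
Proof.
move=> charK0 et_a; apply: raddf_inj => p.
have [k] := ubnP (msize p); elim: k p => // k IHk p lt_pk ap0.
have d0 D : alpha (vapp D p) = 0 by rewrite -vapp_lift // ap0 vapp0.
have dpx : vapp (1, 0) p = p^`M(ix) by rewrite /vapp mul1r mul0r addr0.
have dpy : vapp (0, 1) p = p^`M(iy) by rewrite /vapp mul1r mul0r add0r.
have [p0|nzp] := eqVneq p 0; first by [].
have lt_d i : (msize p^`M(i) < k)%N.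
  apply: leq_ltn_trans (msize_mderiv_le i p) _.
  by rewrite prednK // lt0n msize_poly_eq0.
have px0 : p^`M(ix) = 0 by apply: IHk; rewrite ?lt_d // -dpx; apply: d0.
have py0 : p^`M(iy) = 0 by apply: IHk; rewrite ?lt_d // -dpy; apply: d0.
have pC := mderiv_eq0 charK0 px0 py0.
by rewrite pC -(lrmorphC alpha) -pC.
Qed.

(** * Affine vector fields *)

Lemma span_linear (K : fieldType) (s : seq (Vec K)) (a : K) (D E : Vec K) :
  span s D -> span s E -> span s (a *: D + E).
Proof.
case=> c -> [d ->]; exists (fun i => a * c i + d i).
rewrite scaler_sumr -big_split; apply: eq_bigr => i _.
by rewrite scalerDl scalerA.
Qed.

Lemma span0 (K : fieldType) (s : seq (Vec K)) : span s 0.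
Proof. by exists (fun => 0); rewrite big1 // => i _; rewrite scale0r. Qed.

Lemma span_mem (K : fieldType) (s : seq (Vec K)) (D : Vec K) : D \in s -> span s D.
Proof.
move=> sD; have lt_is : (index D s < size s)%N by rewrite index_mem.
exists (fun i => (i == Ordinal lt_is)%:R).
rewrite (bigD1 (Ordinal lt_is)) //= eqxx scale1r nth_index // big1 ?addr0 //.
by move=> i /negbTE->; rewrite scale0r.
Qed.

Lemma span_ind (K : fieldType) (s : seq (Vec K)) (P : Vec K -> Prop) :
    P 0 -> (forall a D E, P D -> P E -> P (a *: D + E)) ->
    (forall D, D \in s -> P D) ->
  forall D, span s D -> P D.
Proof.
move=> P0 PL Ps D [c ->]; elim/big_ind: _ => // [E F PE PF|i _].
  by rewrite -[E]scale1r; apply: PL.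
by rewrite -[_ *: _]addr0; apply: PL => //; apply: Ps; rewrite mem_nth.
Qed.

Lemma span_sum (K : fieldType) (s : seq (Vec K)) (I : finType) (F : I -> Vec K) :
  (forall i, span s (F i)) -> span s (\sum_i F i).
Proof.
move=> sF; elim/big_ind: _ => // [|D E sD sE]; first exact: span0.
by rewrite -[D]scale1r; apply: span_linear.
Qed.

Lemma span_scale (K : fieldType) (s : seq (Vec K)) (a : K) (D : Vec K) :
  span s D -> span s (a *: D).
Proof. by move=> sD; rewrite -[_ *: _]addr0; apply: span_linear => //; apply: span0. Qed.

Lemma msize_linear (K : fieldType) (k : nat) (a : K) (p q : Pxy K) :
  (msize p <= k)%N -> (msize q <= k)%N -> (msize (a *: p + q) <= k)%N.
Proof.
move=> pk qk; apply: leq_trans (msizeD_le _ _) _; rewrite geq_max qk andbT.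
exact: leq_trans (mmeasureZ_le _ _ _) pk.
Qed.

Lemma msizeM_pred_le (K : fieldType) (a b : nat) (p q : Pxy K) :
  (msize p <= a)%N -> (msize q <= b)%N -> (msize (p * q) <= (a + b).-1)%N.
Proof.
move=> pa qb; have [->|p0] := eqVneq p 0; first by rewrite mul0r msize0.
have [->|q0] := eqVneq q 0; first by rewrite mulr0 msize0.
by rewrite msizeM // -!subn1 leq_sub2r // leq_add.
Qed.

(** Affine fields do not raise degrees; this is what makes aff2 act locally
    finitely. *)
Lemma msize_lie (K : fieldType) (k : nat) (D E : Vec K) :
    (msize D.1 <= 2)%N -> (msize D.2 <= 2)%N ->
    (msize E.1 <= k)%N -> (msize E.2 <= k)%N ->
  (msize (lie D E).1 <= k)%N /\ (msize (lie D E).2 <= k)%N.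
Proof.
move=> D1 D2 E1 E2.
have add (p q : Pxy K) : (msize p <= k)%N -> (msize q <= k)%N -> (msize (p + q) <= k)%N.
  by move=> pk qk; apply: leq_trans (msizeD_le _ _) _; rewrite geq_max pk.
have DE (p q : Pxy K) i : (msize p <= 2)%N -> (msize q <= k)%N -> (msize (p * q^`M(i)) <= k)%N.
  move=> p2 qk; have [->|q0] := eqVneq q 0; first by rewrite mderiv0 mulr0 msize0.
  have q_gt0 : (0 < msize q)%N by rewrite lt0n msize_poly_eq0.
  apply: leq_trans (msizeM_pred_le p2 (msize_mderiv_le i q)) _.
  by rewrite add2n /= prednK.
have ED (p q : Pxy K) i : (msize q <= 2)%N -> (msize p <= k)%N -> (msize (p * q^`M(i)) <= k)%N.
  move=> q2 pk; have q1 : (msize q^`M(i) <= 1)%N.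
    by apply: leq_trans (msize_mderiv_le i q) _; rewrite -subn1 leq_subLR.
  by apply: leq_trans (msizeM_pred_le pk q1) _; rewrite addn1.
rewrite /lie /vapp /=.
by split; (apply: (add); [|rewrite msizeN]); apply: (add); solve [exact: DE | exact: ED].
Qed.

Lemma msize_polX (K : fieldType) : msize (polX K) = 2%N.
Proof. by rewrite msizeX mdeg1. Qed.

Lemma msize_polY (K : fieldType) : msize (polY K) = 2%N.
Proof. by rewrite msizeX mdeg1. Qed.

Lemma mderiv_affine (K : fieldType) (i : 'I_2) (p : Pxy K) :
  (msize p <= 2)%N -> exists a, p^`M(i) = a%:MP.
Proof.
move=> p2; exists (p^`M(i))@_0; apply: msize1_polyC.
by apply: leq_trans (msize_mderiv_le i p) _; rewrite -subn1 leq_subLR.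
Qed.

Lemma msize_le2P (K : fieldType) (p : Pxy K) : has_char0 K ->
  (msize p <= 2)%N -> exists a b c : K, p = a *: polX K + b *: polY K + c%:MP.
Proof.
move=> charK0 p2.
have [[a px] [b py]] := (mderiv_affine ix p2, mderiv_affine iy p2); exists a, b.
pose q := p - (a *: polX K + b *: polY K).
suff qC : q = (q@_0)%:MP by exists (q@_0); rewrite -qC /q addrC subrK.
apply: mderiv_eq0 => //; rewrite mderivB mderivD !mderivZ ?px ?py.
  by rewrite polX_x polY_x scaler0 addr0 -mul_mpolyC mulr1 subrr.
by rewrite polX_y polY_y scaler0 add0r -mul_mpolyC mulr1 subrr.
Qed.

Lemma aff2P (K : fieldType) (D : Vec K) : has_char0 K ->
  aff2 D <-> (msize D.1 <= 2)%N /\ (msize D.2 <= 2)%N.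
Proof.
move=> charK0; split.
  apply: (span_ind (P := fun E => (msize E.1 <= 2)%N /\ (msize E.2 <= 2)%N))
    => [|a E F [E1 E2] [F1 F2]|E]; first by rewrite !msize0.
    by split; apply: msize_linear.
  rewrite !inE => /or4P[/eqP->|/eqP->|/eqP->|/or3P[]/eqP->] /=;
  by rewrite ?msizeN ?msize_polX ?msize_polY ?msize0 ?msize1.
case=> /(msize_le2P charK0)[a [b [c D1]]] /(msize_le2P charK0)[d [e [f D2]]].
have nz2 : (2%:R : K) != 0 by apply: natr_neq0.
rewrite /aff2; set s := [:: _; _; _; _; _; _].
(* The basis contains x d/dx + y d/dy and x d/dx - y d/dy. *)
pose u := (a + e) / 2%:R; pose v := (a - e) / 2%:R.
have aE : a = u + v by rewrite -mulrDl addrACA subrr addr0 -mulr2n -[a *+ 2]mulr_natr mulfK.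
have eE : e = u - v.
  by rewrite -mulrBl opprB [e - a]addrC addrACA subrr add0r -mulr2n -[e *+ 2]mulr_natr mulfK.
have -> : D = c *: (1, 0) + (f *: (0, 1) + (u *: (polX K, polY K)
   + (v *: (polX K, - polY K) + (d *: (0, polX K) + b *: (polY K, 0))))).
  rewrite [D]surjective_pairing D1 D2 aE eE; congr pair;
  rewrite /= -!mul_mpolyC; ring.
have s_ i : (i < 6)%N -> span s s`_i by move=> i6; apply: span_mem; apply: mem_nth.
apply: span_linear; [exact: (s_ 0) | apply: span_linear; first exact: (s_ 1)].
apply: span_linear; [exact: (s_ 2) | apply: span_linear; first exact: (s_ 3)].
apply: span_linear; [exact: (s_ 4) | apply: span_scale; exact: (s_ 5)].
Qed.

Lemma divergence_is_linear (K : fieldType) (a : K) (D E : Vec K) :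
  divergence (a *: D + E) = a *: divergence D + divergence E.
Proof. by rewrite /divergence /= !mderivD !mderivZ scalerDr addrACA. Qed.

Lemma saff2_aff2 (K : fieldType) (D : Vec K) : has_char0 K -> saff2 D -> aff2 D.
Proof.
move=> charK0; rewrite aff2P //.
apply: (span_ind (P := fun E => (msize E.1 <= 2)%N /\ (msize E.2 <= 2)%N))
  => [|a E F [E1 E2] [F1 F2]|E]; first by rewrite !msize0.
  by split; apply: msize_linear.
rewrite !inE => /or4P[/eqP->|/eqP->|/eqP->|/orP[]/eqP->] /=;
by rewrite ?msizeN ?msize_polX ?msize_polY ?msize0 ?msize1.
Qed.

Lemma saff2P (K : fieldType) (D : Vec K) : has_char0 K ->
  saff2 D <-> aff2 D /\ divergence D = 0.
Proof.
move=> charK0; split=> [sD|[]].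
  split; first exact: saff2_aff2.
  move: D sD; apply: span_ind => [|a E F E0 F0|E].
  - by rewrite /divergence !mderiv0 addr0.
  - by rewrite divergence_is_linear E0 F0 scaler0 addr0.
  rewrite !inE /divergence => /or4P[/eqP->|/eqP->|/eqP->|/orP[]/eqP->] /=;
  by rewrite ?mderivN ?polX_x ?polX_y ?polY_x ?polY_y -?mpolyC1 ?mderivC ?mderiv0 ?addr0 ?subrr.
rewrite aff2P // => -[/(msize_le2P charK0)[a [b [c D1]]] /(msize_le2P charK0)[d [e [f D2]]]].
rewrite /divergence D1 D2 !mderivD !mderivZ !mderivC.
rewrite polX_x polX_y polY_x polY_y !scaler0 !addr0 add0r -scalerDl.
move=> /eqP; rewrite -mul_mpolyC mulr1 mpolyC_eq0 addr_eq0 => /eqP aE.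
rewrite /saff2; set s := [:: _; _; _; _; _].
have -> : D = c *: (1, 0) + (f *: (0, 1) + (a *: (polX K, - polY K)
    + (d *: (0, polX K) + b *: (polY K, 0)))).
  rewrite [D]surjective_pairing D1 D2 aE; congr pair;
  rewrite /= -!mul_mpolyC; ring.
have s_ i : (i < 5)%N -> span s s`_i by move=> i5; apply: span_mem; apply: mem_nth.
apply: span_linear; [exact: (s_ 0) | apply: span_linear; first exact: (s_ 1)].
apply: span_linear; [exact: (s_ 2) | apply: span_linear; first exact: (s_ 3)].
apply: span_scale; exact: (s_ 4).
Qed.

Lemma aff2_constant_divergence (K : fieldType) (D : Vec K) :
  has_char0 K -> aff2 D -> constant_divergence D.
Proof.
move=> charK0 /(aff2P _ charK0)[D1 D2]; exists ((divergence D)@_0).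
apply: msize1_polyC; apply: leq_trans (msizeD_le _ _) _; rewrite geq_max.
by apply/andP; split; apply: leq_trans (msize_mderiv_le _ _) _; rewrite -subn1 leq_subLR.
Qed.

Lemma lie_subalgebra_aff2 (K : fieldType) :
  has_char0 K -> lie_subalgebra (@aff2 K).
Proof.
move=> charK0; split; [exact: span0 | by move=> *; apply: span_linear |].
move=> D E /(aff2P _ charK0)[D1 D2] /(aff2P _ charK0)[E1 E2].
by apply/aff2P => //; apply: msize_lie.
Qed.

Lemma lie_subalgebra_saff2 (K : fieldType) :
  has_char0 K -> lie_subalgebra (@saff2 K).
Proof.
move=> charK0; split; [exact: span0 | by move=> *; apply: span_linear |].
move=> D E sD sE; have [_ _ lie_aff2] := lie_subalgebra_aff2 charK0.
have [aD aE] := (saff2_aff2 charK0 sD, saff2_aff2 charK0 sE).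
apply/saff2P => //; split; first exact: lie_aff2.
by apply: divergence_lie0; apply: aff2_constant_divergence.
Qed.

(** Only saff2 and aff2 themselves are of interest; this predicate collects what
    the argument uses about them, so that both are treated at once. *)
Definition affine_algebra (K : fieldType) (M : Vec K -> Prop) :=
  [/\ lie_subalgebra M, (forall D, saff2 D -> M D) & (forall D, M D -> aff2 D)].

Lemma affine_algebra_generators (K : fieldType) (M : Vec K -> Prop) :
  affine_algebra M ->
  [/\ M (1, 0), M (0, 1), M (polX K, - polY K), M (0, polX K) & M (polY K, 0)].
Proof.
case=> _ sM _.
have M_ i : (i < 5)%N ->
    M [:: (1, 0); (0, 1); (polX K, - polY K); (0, polX K); (polY K, 0)]`_i.
  by move=> i5; apply: sM; apply: span_mem; apply: mem_nth.
split; [exact: (M_ 0) | exact: (M_ 1) | exact: (M_ 2) | exact: (M_ 3) | exact: (M_ 4)].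
Qed.

Lemma affine_algebra_aff2 (K : fieldType) :
  has_char0 K -> affine_algebra (@aff2 K).
Proof.
by move=> charK0; split=> // [|D]; [apply: lie_subalgebra_aff2 | apply: saff2_aff2].
Qed.

Lemma affine_algebra_saff2 (K : fieldType) :
  has_char0 K -> affine_algebra (@saff2 K).
Proof.
by move=> charK0; split=> // [|D]; [apply: lie_subalgebra_saff2 | apply: saff2_aff2].
Qed.

Lemma affine_algebra_type (K : fieldType) (M : Vec K -> Prop) :
  has_char0 K -> affine_algebra M -> subalgebra_of_type M M.
Proof.
move=> charK0 [algM _ Maff]; split=> //.
  by move=> D /Maff; apply: aff2_constant_divergence.
by exists id; split=> // E; split=> [ME|[D MD <-] //]; exists E.
Qed.

Lemma affine_algebra_algebraic (K : fieldType) (M : Vec K -> Prop) :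
  has_char0 K -> affine_algebra M -> algebraic M.
Proof.
move=> charK0 [_ _ Maff] D; pose k := maxn (msize D.1) (msize D.2).
pose s : seq (Vec K) := [seq ('X_[m], 0) | m : 'X_{1..2 < k}]
                     ++ [seq (0, 'X_[m]) | m : 'X_{1..2 < k}].
have bound E : span s E -> (msize E.1 <= k)%N /\ (msize E.2 <= k)%N.
  apply: (span_ind (P := fun E => (msize E.1 <= k)%N /\ (msize E.2 <= k)%N))
    => [|a F G [F1 F2] [G1 G2]|F]; first by rewrite !msize0.
    by split; apply: msize_linear.
  by rewrite mem_cat => /orP[] /mapP[m _ ->] /=; rewrite msize0 msizeX bmdeg.
have span_bound E : (msize E.1 <= k)%N -> (msize E.2 <= k)%N -> span s E.
  move=> E1 E2; have -> : E = 1 *: \sum_(m : 'X_{1..2 < k}) E.1@_m *: ('X_[m], 0)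
                   + \sum_(m : 'X_{1..2 < k}) E.2@_m *: (0, 'X_[m]).
    rewrite scale1r [LHS]surjective_pairing [E.1 in LHS](mpolywE E1) [E.2 in LHS](mpolywE E2).
    rewrite -[RHS]/(_, _); congr pair.
      rewrite [RHS]/= !(raddf_sum fst) /= [X in _ + X]big1 ?addr0 // => m _.
      by rewrite scaler0.
    rewrite [RHS]/= !(raddf_sum snd) /= [X in X + _]big1 ?add0r // => m _.
    by rewrite scaler0.
  apply: span_linear; apply: span_sum => m; apply: span_scale; apply: span_mem;
  rewrite mem_cat; apply/orP; [left | right]; apply: map_f; exact: mem_enum.
exists s; first by apply: span_bound; rewrite leq_max leqnn ?orbT.
move=> E F /Maff/(aff2P _ charK0)[E1 E2] /bound[F1 F2].
by have [] := msize_lie E1 E2 F1 F2; apply: span_bound.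
Qed.

(** * Subalgebras of affine type are lifts *)

(** The fields u, v, e, h have the brackets of dx, dy, y dx and x dx - y dy.  The
    determinant of e and u is a constant of weight -3 for h, hence zero.  If u
    and v were also parallel, so would be e and v, and then their bracket -u
    would vanish. *)
Lemma cross_neq0 (K : fieldType) (u v e h : Vec K) : has_char0 K ->
    divergence u = 0 -> divergence v = 0 -> divergence e = 0 -> divergence h = 0 ->
    lie u v = 0 -> lie e u = 0 -> lie e v = - u ->
    lie h e = (- 2%:R) *: e -> lie h u = - u -> u != 0 ->
  cross u v != 0.
Proof.
move=> charK0 du dv de dh uv eu ev he hu u0; apply/eqP => cuv.
have ceu : cross e u = 0.
  have k := commuting_const_cross charK0 de du eu.
  have := vapp_cross h e u; rewrite {1}k vappC dh mul0r addr0 he hu.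
  have -> : cross ((- 2%:R) *: e) u + cross e (- u) = - (3%:R *: cross e u).
    rewrite /cross /= -!mul_mpolyC; ring.
  move/esym/eqP; rewrite oppr_eq0 scaler_eq0 (negbTE (natr_neq0 2 charK0)).
  by move=> /eqP.
have cev := cross_trans u0 ceu cuv.
have := lie_hamiltonian de dv; rewrite ev cev !mderiv0 oppr0 => /eqP.
by rewrite oppr_eq0 (negbTE u0).
Qed.

(** Divergence-free fields have Hamiltonians f and g, and their determinant c is
    the Jacobian of (f, g).  Both potentials are divided by c so that u and v
    become dual to the coordinates. *)
Lemma exists_etale_lift (K : fieldType) (u v : Vec K) : has_char0 K ->
    divergence u = 0 -> divergence v = 0 -> lie u v = 0 -> cross u v != 0 ->
  exists alpha : {lrmorphism Pxy K -> Pxy K},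
    [/\ etale alpha, lift alpha (1, 0) = u & lift alpha (0, 1) = v].
Proof.
move=> charK0 du dv uv cuv0.
have := commuting_const_cross charK0 du dv uv; set c := (_ @_ _) => cuv.
have c0 : c != 0 by rewrite -(mpolyC_eq0 2) -cuv.
have [f [fx fy]] : exists f : Pxy K, f^`M(ix) = v.2 /\ f^`M(iy) = - v.1.
  apply: poincare => //; apply/eqP; rewrite mderivN -addr_eq0 addrC; exact/eqP.
have [g [gx gy]] : exists g : Pxy K, g^`M(ix) = - u.2 /\ g^`M(iy) = u.1.
  apply: poincare => //; apply/esym/eqP; rewrite mderivN -addr_eq0; exact/eqP.
have [alpha [aX aY]] := exists_endomorphism (c^-1 *: f) (c^-1 *: g).
have jac : jacobian alpha = (c^-1)%:MP.
  rewrite /jacobian aX aY !mderivZ fx fy gx gy.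
  transitivity ((c^-1 * c^-1) *: cross u v).
    rewrite /cross -!mul_mpolyC rmorphM /=; ring.
  by rewrite cuv -mul_mpolyC -rmorphM /= divfK.
exists alpha; split.
- by exists c^-1; rewrite ?invr_eq0.
- rewrite [RHS]surjective_pairing /lift jac mcoeffC eqxx mulr1 invrK aX aY.
  rewrite /= rmorph1 rmorph0 !mul1r !mul0r subr0 sub0r !mderivZ gx gy.
  by congr pair; rewrite /= ?scalerN ?opprK scalerA mulfV // scale1r.
- rewrite [RHS]surjective_pairing /lift jac mcoeffC eqxx mulr1 invrK aX aY.
  rewrite /= rmorph1 rmorph0 !mul1r !mul0r subr0 sub0r !mderivZ fx fy.
  by congr pair; rewrite /= ?scalerN ?opprK scalerA mulfV // scale1r.
Qed.

(** A field commuting with the lifts of dx and dy sends alpha(x) and alpha(y) to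
    elements killed by both lifts, that is, to constants. *)
Lemma lift_centralizer (K : fieldType) (alpha : {lrmorphism Pxy K -> Pxy K})
    (C : Vec K) : has_char0 K -> etale alpha ->
    lie C (lift alpha (1, 0)) = 0 -> lie C (lift alpha (0, 1)) = 0 ->
  exists a b : K, C = lift alpha (a *: (1, 0) + b *: (0, 1)).
Proof.
move=> charK0 et_a Cu Cv.
(* C maps alpha(p) to a constant as soon as dx(p) and dy(p) are constant. *)
have cst (p : Pxy K) (d e : K) : vapp (1, 0) p = d%:MP -> vapp (0, 1) p = e%:MP ->
    exists a : K, vapp C (alpha p) = a%:MP.
  move=> pd pe; exists ((vapp C (alpha p))@_0).
  have kill D (r : K) : vapp D p = r%:MP -> lie C (lift alpha D) = 0 ->
      vapp (lift alpha D) (vapp C (alpha p)) = 0.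
    move=> Dp CD; have := lieE C (lift alpha D) (alpha p).
    rewrite CD vapp_lift // Dp lrmorphC vappC sub0r => /esym/eqP.
    by rewrite /vapp /= !mul0r addr0 oppr_eq0 => /eqP.
  have [px py] := cross_vapp (lift_unit_cross et_a) (kill _ _ pd Cu) (kill _ _ pe Cv).
  exact: mderiv_eq0.
have [a Ca] : exists a : K, vapp C (alpha (polX K)) = a%:MP.
  by apply: (@cst _ 1 0); rewrite vapp_polX.
have [b Cb] : exists b : K, vapp C (alpha (polY K)) = b%:MP.
  by apply: (@cst _ 0 1); rewrite vapp_polY.
exists a, b; apply: (etale_field_inj et_a) => p; rewrite chain_rule Ca Cb.
rewrite vapp_lift // -(lrmorphC alpha a) -(lrmorphC alpha b) -!rmorphM -rmorphD.
congr (alpha _); rewrite /vapp /= !scaler0 addr0 add0r -!mul_mpolyC !mulr1.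
by congr (_ + _); rewrite mulrC.
Qed.

(** In an affine algebra the constant fields form an ideal. *)
Lemma lie_affine_unit (K : fieldType) (D E : Vec K) : has_char0 K ->
    aff2 D -> E = (1, 0) \/ E = (0, 1) ->
  exists a b : K, lie D E = a *: (1, 0) + b *: (0, 1).
Proof.
move=> charK0 /(aff2P _ charK0)[D1 D2] unitE.
have [i Ei] : exists i, forall p, vapp E p = p^`M(i).
  by case: unitE => ->; [exists ix | exists iy] => p; rewrite /vapp /= mul1r mul0r ?addr0 ?add0r.
have [a D1i] := mderiv_affine i D1; have [b D2i] := mderiv_affine i D2.
exists (- a), (- b); rewrite /lie !Ei D1i D2i.
have [-> ->] : vapp D E.1 = 0 /\ vapp D E.2 = 0.
  by case: unitE => -> /=; rewrite vapp0 -mpolyC1 vappC.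
congr pair; rewrite /= !scaler0 sub0r ?addr0 ?add0r -mul_mpolyC mulr1 rmorphN //.
Qed.

Lemma lie_weight_x (K : fieldType) :
  lie (polX K, - polY K) (1, 0) = -1 *: (1, 0).
Proof.
rewrite /lie /vapp /= !(mderivN, polX_x, polX_y, polY_x, polY_y).
by rewrite -mpolyC1 !mderivC ?mderiv0; congr pair; rewrite /= -mul_mpolyC; ring.
Qed.

Lemma lie_weight_y (K : fieldType) :
  lie (polX K, - polY K) (0, 1) = 1 *: (0, 1).
Proof.
rewrite /lie /vapp /= !(mderivN, polX_x, polX_y, polY_x, polY_y).
by rewrite -mpolyC1 !mderivC ?mderiv0; congr pair; rewrite /= -mul_mpolyC; ring.
Qed.

(** Let u, v correspond to dx, dy, and choose alpha lifting dx, dy to u, v.  For D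
    in L with image D' in M, the fields D and lift D' have the same brackets
    with u and v, as these brackets are again combinations of u and v.  So D and
    lift D' differ by a combination of u and v, which lies both in L and in the
    lift of M. *)
Lemma affine_type_lift (K : fieldType) (M L : Vec K -> Prop) :
    has_char0 K -> affine_algebra M -> subalgebra_of_type M L ->
  exists2 alpha : {lrmorphism Pxy K -> Pxy K}, etale alpha &
    forall E, L E <-> exists2 D, M D & lift alpha D = E.
Proof.
move=> charK0 affM [[L0 Llin Llie] Ldiv [phi [phil phiL phi_inj phiM]]].
have [[M0 Mlin Mlie] _ Ma] := affM.
have [Mx My Mh Mf Me] := affine_algebra_generators affM.
have phi0 : phi 0 = 0.
  by have := phil (-1) 0 0 L0 L0; rewrite scaler0 addr0 scaleN1r addNr.
have [u Lu phiu] : exists2 u, L u & phi u = (1, 0) by apply/phiM.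
have [v Lv phiv] : exists2 v, L v & phi v = (0, 1) by apply/phiM.
have [h Lh phih] : exists2 h, L h & phi h = (polX K, - polY K) by apply/phiM.
have [f Lf phif] : exists2 f, L f & phi f = (0, polX K) by apply/phiM.
have [e Le phie] : exists2 e, L e & phi e = (polY K, 0) by apply/phiM.
have bracket (D E F : Vec K) (a : K) : L D -> L E -> L F ->
    lie (phi D) (phi E) = a *: phi F -> lie D E = a *: F.
  move=> LD LE LF DE; have LaF : L (a *: F) by rewrite -[a *: F]addr0; apply: (Llin).
  apply: phi_inj => //; first exact: Llie.
  by rewrite phiL // DE -[a *: F in RHS]addr0 phil // phi0 addr0.
have vp (D : Vec K) p : vapp D p = D.1 * p^`M(ix) + D.2 * p^`M(iy) by [].
have simp := (vp, polX_x, polX_y, polY_x, polY_y, mderivN, mderiv0).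
have one_d i : (1 : Pxy K)^`M(i) = 0 by rewrite -mpolyC1 mderivC.
have calc (D E F : Vec K) : (lie D E).1 = F.1 -> (lie D E).2 = F.2 -> lie D E = F.
  by move=> e1 e2; rewrite [LHS]surjective_pairing e1 e2 -surjective_pairing.
have uv : lie u v = 0.
  rewrite -[RHS](scale0r u); apply: bracket => //; rewrite phiu phiv.
  apply: calc; rewrite /= !(simp, one_d) /= -?mul_mpolyC; ring.
have eu : lie e u = 0.
  rewrite -[RHS](scale0r u); apply: bracket => //; rewrite phiu phie.
  apply: calc; rewrite /= !(simp, one_d) /= -?mul_mpolyC; ring.
have ev : lie e v = -1 *: u.
  apply: bracket => //; rewrite phiu phie phiv.
  apply: calc; rewrite /= !(simp, one_d) /= -?mul_mpolyC; ring.
have he : lie h e = (-2%:R) *: e.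
  apply: bracket => //; rewrite phih phie.
  apply: calc; rewrite /= !(simp, one_d) /= -?mul_mpolyC; ring.
have hu : lie h u = -1 *: u.
  by apply: bracket => //; rewrite phiu phih lie_weight_x.
have hv : lie h v = 1 *: v.
  by apply: bracket => //; rewrite phiv phih lie_weight_y.
have ef : lie e f = -1 *: h.
  apply: bracket => //; rewrite phie phih phif.
  apply: calc; rewrite /= !(simp, one_d) /= -?mul_mpolyC; ring.
(* u, v, h and e are brackets of fields of constant divergence; the field f only
   serves to write h in this way. *)
have div0 (D E F : Vec K) (a : K) : a != 0 -> L D -> L E -> lie D E = a *: F -> divergence F = 0.
  move=> a0 LD LE DE; have := divergence_lie0 (Ldiv _ LD) (Ldiv _ LE).
  rewrite DE -[a *: F]addr0 divergence_is_linear /divergence !mderiv0 !addr0 => /eqP.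
  by rewrite scaler_eq0 (negbTE a0) => /eqP.
have n1 : -1 != 0 :> K by rewrite oppr_eq0 oner_eq0.
have du := div0 _ _ _ _ n1 Lh Lu hu.
have dv := div0 _ _ _ _ (oner_neq0 K) Lh Lv hv.
have dh := div0 _ _ _ _ n1 Le Lf ef.
have n2 : - 2%:R != 0 :> K by rewrite oppr_eq0 natr_neq0.
have de := div0 _ _ _ _ n2 Lh Le he.
have u0 : u != 0.
  apply: contra_neq (oner_neq0 (Pxy K)) => u0.
  by move: (congr1 fst phiu); rewrite u0 phi0 /= => <-.
have cuv : cross u v != 0.
  apply: (cross_neq0 charK0 du dv de dh uv eu) => //.
  - by rewrite ev scaleN1r.
  - by rewrite hu scaleN1r.
have [alpha [et_a lu lv]] := exists_etale_lift charK0 du dv uv cuv.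
have lift_lin := lift_is_linear _ _ _ et_a.
have lift_unit a b : lift alpha (a *: (1, 0) + b *: (0, 1)) = a *: u + b *: v.
  by rewrite lift_lin lu liftZ // lv.
have Luv a b : L (a *: u + b *: v).
  by apply: (Llin) => //; rewrite -[b *: v]addr0; apply: (Llin).
have phi_unit a b : phi (a *: u + b *: v) = a *: (1, 0) + b *: (0, 1).
  have Lbv : L (b *: v) by rewrite -[b *: v]addr0; apply: (Llin).
  by rewrite phil // phiu -[b *: v]addr0 phil // phi0 phiv addr0.
have Munit a b : M (a *: (1, 0) + b *: (0, 1)).
  by apply/phiM; exists (a *: u + b *: v).
have key D : L D -> exists a b, D = lift alpha (phi D) + (a *: u + b *: v).
  move=> LD; have MD : M (phi D) by apply/phiM; exists D.
  have same (w E : Vec K) : L w -> phi w = E -> E = (1, 0) \/ E = (0, 1) -> lift alpha E = w ->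
      lie (D - lift alpha (phi D)) (lift alpha E) = 0.
    move=> Lw phiw Eunit lE.
    rewrite -[D - _]addrC -scaleN1r lie_linearl scaleN1r.
    have [a [b DE]] := lie_affine_unit charK0 (Ma _ MD) Eunit.
    rewrite -lift_lie // DE lift_unit lE.
    apply/eqP; rewrite addrC subr_eq0; apply/eqP.
    by apply: phi_inj; rewrite ?phi_unit ?phiL ?phiw //; apply: Llie.
  have Cu := same u (1, 0) Lu phiu (or_introl erefl) lu.
  have Cv := same v (0, 1) Lv phiv (or_intror erefl) lv.
  have [a [b C]] := lift_centralizer charK0 et_a Cu Cv.
  by exists a, b; rewrite -lift_unit -C addrC subrK.
exists alpha => // E; split=> [LE|[D MD <-]].
  have [a [b ->]] := key E LE.
  exists (1 *: phi E + (a *: (1, 0) + b *: (0, 1))).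
    by apply: Mlin => //; apply/phiM; exists E.
  by rewrite lift_lin scale1r lift_unit.
have [D0 LD0 <-] : exists2 D0, L D0 & phi D0 = D by apply/phiM.
have [a [b D0E]] := key D0 LD0.
rewrite (_ : lift _ _ = (-1) *: (a *: u + b *: v) + D0); first exact: Llin.
by rewrite [in RHS]D0E scaleN1r addrC addrK.
Qed.

(** * Local finiteness forces local nilpotency *)

(** The relation says that a nonzero polynomial c(U), of degree less than n, kills
    W.  Commuting c(U) with H shows that a U c'(U) kills W too, so the combination
    U c'(U) - d c(U), where d = deg c, is a relation of smaller degree.  The descent
    stops only at a monomial. *)
Lemma nilpotent_of_relation (K : fieldType) (V : lmodType K) (U H : {linear V -> V})
    (W : V -> Prop) (a : K) (n : nat) (c : nat -> K) : has_char0 K -> a != 0 ->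
    (forall w, H (U w) = U (H w) + a *: U w) -> (forall w, W w -> W (H w)) ->
    (exists2 i : nat, (i < n)%N & c i != 0) ->
    (forall w, W w -> \sum_(i < n) c i *: iter i U w = 0) ->
  exists k, forall w, W w -> iter k U w = 0.
Proof.
move=> charK0 a0 HU HW.
have HUi i w : H (iter i U w) = iter i U (H w) + (a * i%:R) *: iter i U w.
  elim: i => [|i IHi]; first by rewrite mulr0 scale0r addr0.
  rewrite !iterS HU IHi linearD linearZ /= -addrA -scalerDl; congr (_ + _ *: _).
  by rewrite -natr1 mulrDr mulr1.
elim: n c => [|n IHn] c; first by case.
case=> i; rewrite ltnS => le_in ci0 rel.
have [cn0|cn0] := eqVneq (c n) 0.
  apply: (IHn c); last by move=> w /rel; rewrite big_ord_recr /= cn0 scale0r addr0.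
  exists i => //; rewrite ltn_neqAle le_in andbT.
  by apply: contraNneq ci0 => ->; rewrite cn0.
have [/existsP[j cj0] | /existsPn c_0] := boolP [exists j : 'I_n, c j != 0].
  apply: (IHn (fun j => (j%:R - n%:R) * c j)).
    exists j => //; rewrite mulf_neq0 // -opprB oppr_eq0 -natrB ?(ltnW (ltn_ord j)) //.
    by move/pcharf0P: charK0 => ->; rewrite subn_eq0 -ltnNge.
  move=> w Ww.
  (* Apply H to the relation at w, and subtract the relation at H w and
     a n times the relation at w: the top term cancels. *)
  have: a *: \sum_(j < n.+1) ((j%:R - n%:R) * c j) *: iter j U w = 0.
    have relH := congr1 H (rel w Ww); rewrite linear_sum linear0 in relH.
    transitivity (\sum_(j < n.+1) H (c j *: iter j U w)
       - \sum_(j < n.+1) c j *: iter j U (H w)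
       - (a * n%:R) *: \sum_(j < n.+1) c j *: iter j U w).
      rewrite !scaler_sumr -!sumrB; apply: eq_bigr => k _.
      rewrite [H _]linearZ /= HUi scalerDr [_ + (c k *: _)]addrC addrK.
      rewrite !scalerA -scalerBl; congr (_ *: _).
      ring.
    by rewrite relH (rel _ Ww) (rel _ (HW _ Ww)) scaler0 !subr0.
  by move/eqP; rewrite scaler_eq0 (negbTE a0) big_ord_recr /= subrr mul0r scale0r addr0 => /eqP.
exists n => w /rel; rewrite big_ord_recr big1 /= => [|j _]; last first.
  by move: (c_0 j); rewrite negbK => /eqP->; rewrite scale0r.
by rewrite add0r => /eqP; rewrite scaler_eq0 (negbTE cn0) => /eqP.
Qed.

(** The Cayley-Hamilton theorem for a matrix describing U on the generating
    family, which need not be free. *)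
Lemma span_relation (K : fieldType) (U : {linear Vec K -> Vec K}) (s : seq (Vec K)) :
    (forall w, span s w -> span s (U w)) ->
  exists n (c : nat -> K), (exists2 i : nat, (i < n)%N & c i != 0) /\
    forall w, span s w -> \sum_(i < n) c i *: iter i U w = 0.
Proof.
move=> sU; pose n := size s.
(* The index n, at which nth returns 0, keeps the matrix nonempty. *)
have ex i : exists r : 'rV[K]_n.+1, U s`_i = \sum_j r 0 j *: s`_j.
  have [lt_in|le_ni] := ltnP i n; last first.
    exists 0; rewrite nth_default // linear0 big1 // => j _.
    by rewrite mxE scale0r.
  have [c ->] := sU _ (span_mem (mem_nth 0 lt_in)).
  exists (\row_j oapp c 0 (insub (val j))).
  rewrite big_ord_recr /= nth_default // scaler0 addr0; apply: eq_bigr => j _.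
  by rewrite mxE /= (valK j).
have /fin_all_exists[r Ur] i := ex (nat_of_ord (i : 'I_n.+1)).
pose A := \matrix_i r i.
have UAk k (i : 'I_n.+1) : iter k U s`_i = \sum_j (A ^+ k) i j *: s`_j.
  elim: k i => [|k IHk] i.
    rewrite expr0 (bigD1 i) //= big1 ?addr0 => [|j ne_ji].
      by rewrite mxE eqxx scale1r.
    by rewrite mxE eq_sym (negbTE ne_ji) scale0r.
  rewrite iterS IHk linear_sum exprSr /=.
  under eq_bigr => j _ do rewrite linearZ /= Ur scaler_sumr.
  rewrite exchange_big; apply: eq_bigr => l _; rewrite mxE scaler_suml.
  by apply: eq_bigr => j _; rewrite scalerA [A j l]mxE.
pose q := char_poly A.
exists (size q), (fun i => q`_i); split.
  exists (size q).-1; last by rewrite -/(lead_coef q) lead_coef_eq0 monic_neq0 ?char_poly_monic.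
  by rewrite prednK // size_poly_gt0 monic_neq0 ?char_poly_monic.
have qA : \sum_(i < size q) q`_i *: A ^+ i = 0.
  transitivity (horner_mx A q); last exact: Cayley_Hamilton.
  rewrite -[q in RHS]coefK poly_def raddf_sum.
  by apply: eq_bigr => i _; rewrite /= linearZ rmorphXn /= horner_mx_X.
have lin_iter k a D E : iter k U (a *: D + E) = a *: iter k U D + iter k U E.
  by elim: k => //= k ->; rewrite linearP.
have iter0 k : iter k U 0 = 0 by elim: k => //= k ->; rewrite linear0.
apply: (span_ind (P := fun w => \sum_(i < size q) q`_i *: iter i U w = 0))
  => [|a D E D0 E0|D /(nthP 0)[i lt_i <-]].
- by rewrite big1 // => i _; rewrite iter0 scaler0.
- under eq_bigr => i _ do rewrite lin_iter scalerDr scalerA mulrC -scalerA.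
  by rewrite big_split -scaler_sumr /= D0 E0 scaler0 addr0.
have lt_in : (i < n.+1)%N by rewrite ltnW.
under eq_bigr => k _ do rewrite (UAk k (Ordinal lt_in)) scaler_sumr.
rewrite exchange_big big1 // => j _.
under eq_bigr => k _ do rewrite scalerA.
rewrite -scaler_suml.
have /matrixP/(_ (Ordinal lt_in) j) := qA; rewrite mxE summxE => qAij.
rewrite (_ : \sum_k _ = 0) ?scale0r // -[RHS]qAij.
by apply: eq_bigr => k _; rewrite mxE.
Qed.

Lemma lie_jacobi (K : fieldType) (D E F : Vec K) :
  lie D (lie E F) = lie E (lie D F) + lie (lie D E) F.
Proof.
apply: eq_field => f.
rewrite vappDl !lieE !vappB; ring.
Qed.

(** Since ad(u) maps p u to u(p) u, nilpotency of ad(u) on a finite-dimensional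
    space containing p u yields nilpotency of u on p. *)
Lemma locally_nilpotent (K : fieldType) (L : Vec K -> Prop) (h u : Vec K) (a : K) :
    has_char0 K -> algebraic L -> L h -> L u -> u != 0 -> a != 0 ->
    lie h u = a *: u ->
  forall p, exists k, iter k (vapp u) p = 0.
Proof.
move=> charK0 algL Lh Lu u0 a0 hu p.
have [s sD sL] := algL (p * u.1, p * u.2).
have [n [c [nzc rel]]] := span_relation (fun w => sL u w Lu).
have hu_w w : lie h (lie u w) = lie u (lie h w) + a *: lie u w.
  by rewrite lie_jacobi hu -[a *: u]addr0 lie_linearl [lie 0 w]lieC linear0 oppr0 addr0.
have [k nil] := nilpotent_of_relation (H := lie h) charK0 a0 hu_w (fun w => sL h w Lh) nzc rel.
exists k; have := nil _ sD.
have iterE q j : iter j (lie u) (q * u.1, q * u.2)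
    = (iter j (vapp u) q * u.1, iter j (vapp u) q * u.2).
  elim: j => //= j ->; rewrite /lie !vappM; congr pair; rewrite /vapp /=; ring.
rewrite iterE => pu0; apply: contra_neq_eq u0 => nz.
rewrite [u]surjective_pairing; congr pair; apply: (mulfI nz); rewrite mulr0.
  exact: (congr1 fst pu0).
exact: (congr1 snd pu0).
Qed.

(** * The equivalences *)

(** By induction on the exponents killing p, the derivatives u(p) and v(p) are
    alpha(P) and alpha(Q).  As u and v commute and alpha is injective, (P, Q) is
    closed, with a potential R, and p - alpha(R) is constant. *)
Lemma etale_surj (K : fieldType) (alpha : {lrmorphism Pxy K -> Pxy K}) :
    has_char0 K -> etale alpha ->
    (forall p, exists k, iter k (vapp (lift alpha (1, 0))) p = 0) ->
    (forall p, exists k, iter k (vapp (lift alpha (0, 1))) p = 0) ->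
  forall p, exists q, alpha q = p.
Proof.
move=> charK0 et_a; set u := lift alpha (1, 0); set v := lift alpha (0, 1).
have dx q : vapp u (alpha q) = alpha q^`M(ix).
  by rewrite vapp_lift // /vapp mul1r mul0r addr0.
have dy q : vapp v (alpha q) = alpha q^`M(iy).
  by rewrite vapp_lift // /vapp mul1r mul0r add0r.
have uv p : vapp u (vapp v p) = vapp v (vapp u p).
  apply/eqP; rewrite -subr_eq0 -lieE -lift_lie //; apply/eqP.
  have -> : lie (1, 0) (0, 1) = 0 :> Vec K.
    by rewrite /lie /= -mpolyC1 !(vappC, vapp0) subrr.
  by rewrite lift0 /vapp /= !mul0r addr0.
move=> nilu nilv p; have [[a pa] [b pb]] := (nilu p, nilv p).
elim: a p pa b pb => [|a IHa] p; first by move=> /= -> *; exists 0; rewrite rmorph0.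
move=> pa b; elim: b p pa => [|b IHb] p pa; first by move=> /= ->; exists 0; rewrite rmorph0.
move=> pb.
have iter_uv (w w' : Vec K) j q : (forall p, vapp w (vapp w' p) = vapp w' (vapp w p)) ->
    iter j (vapp w) (vapp w' q) = vapp w' (iter j (vapp w) q).
  by move=> ww'; elim: j => //= j ->.
have [||P aP] := IHa (vapp u p) _ b.+1.
- by rewrite -iterSr.
- by rewrite iter_uv ?pb ?vapp0.
have [||Q aQ] := IHb (vapp v p).
- by rewrite iter_uv ?pa ?vapp0.
- by rewrite -iterSr.
have [R [Rx Ry]] : exists R : Pxy K, R^`M(ix) = P /\ R^`M(iy) = Q.
  apply: poincare => //; apply: (etale_inj charK0 et_a).
  by rewrite -dx -dy aP aQ uv.
have [] := cross_vapp (f := p - alpha R) (lift_unit_cross et_a).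
- by rewrite vappB dx Rx aP subrr.
- by rewrite vappB dy Ry aQ subrr.
move=> /(mderiv_eq0 charK0) cst /cst; set c := (_ @_ _) => pR.
by exists (c%:MP + R); rewrite rmorphD /= lrmorphC -pR subrK.
Qed.

(** An explicit left inverse of alpha on polynomials of degree at most 1: the
    linear coefficients are read off with the lifts of dx and dy. *)
Definition affine_part (K : fieldType) (alpha : Pxy K -> Pxy K) (q : Pxy K) : Pxy K :=
  let a := (vapp (lift alpha (1, 0)) q)@_0 in
  let b := (vapp (lift alpha (0, 1)) q)@_0 in
  let r := q - a *: alpha (polX K) - b *: alpha (polY K) in
  a *: polX K + b *: polY K + (r@_0)%:MP.

Lemma affine_partK (K : fieldType) (alpha : {lrmorphism Pxy K -> Pxy K}) (p : Pxy K) :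
  has_char0 K -> etale alpha -> (msize p <= 2)%N -> affine_part alpha (alpha p) = p.
Proof.
move=> charK0 et_a /(msize_le2P charK0)[a [b [c ->]]].
rewrite /affine_part !vapp_lift //.
have -> : vapp (1, 0) (a *: polX K + b *: polY K + c%:MP) = a%:MP.
  rewrite /vapp /= mul1r mul0r addr0 !mderivD !mderivZ mderivC polX_x polY_x.
  by rewrite scaler0 !addr0 -mul_mpolyC mulr1.
have -> : vapp (0, 1) (a *: polX K + b *: polY K + c%:MP) = b%:MP.
  rewrite /vapp /= mul1r mul0r add0r !mderivD !mderivZ mderivC polX_y polY_y.
  by rewrite scaler0 !addr0 add0r -mul_mpolyC mulr1.
have -> : alpha (a *: polX K + b *: polY K + c%:MP)
    = a *: alpha (polX K) + b *: alpha (polY K) + c%:MP.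
  by rewrite !linearD !linearZ /= lrmorphC.
rewrite !lrmorphC !mcoeffC eqxx !mulr1.
have -> : a *: alpha (polX K) + b *: alpha (polY K) + c%:MP
    - a *: alpha (polX K) - b *: alpha (polY K) = c%:MP by ring.
by rewrite mcoeffC eqxx mulr1.
Qed.

(** The isomorphism to M required here is the inverse of the lift, which sends E
    to the affine parts of E(alpha(x)) and E(alpha(y)). *)
Lemma lift_of_type (K : fieldType) (M : Vec K -> Prop)
    (alpha : {lrmorphism Pxy K -> Pxy K}) :
    has_char0 K -> affine_algebra M -> etale alpha ->
  subalgebra_of_type M (fun E => exists2 D, M D & lift alpha D = E).
Proof.
move=> charK0 affM et_a; have [[M0 Mlin Mlie] _ Ma] := affM.
have lift_lin := lift_is_linear _ _ _ et_a.
pose phi (E : Vec K) : Vec K :=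
  (affine_part alpha (vapp E (alpha (polX K))), affine_part alpha (vapp E (alpha (polY K)))).
have phiK D : M D -> phi (lift alpha D) = D.
  move=> /Ma/(aff2P _ charK0)[D1 D2]; rewrite /phi !vapp_lift // vapp_polX vapp_polY.
  by rewrite !affine_partK // -surjective_pairing.
split.
- split; first by exists 0; rewrite ?lift0 //.
    by move=> a _ _ [D MD <-] [E ME <-]; exists (a *: D + E); [apply: Mlin | apply: lift_lin].
  move=> _ _ [D MD <-] [E ME <-]; exists (lie D E); first exact: Mlie.
  by rewrite lift_lie.
- move=> _ [D MD <-]; have [c Dc] := aff2_constant_divergence charK0 (Ma _ MD).
  by exists c; rewrite divergence_lift // Dc lrmorphC.
exists phi; split.
- move=> a _ _ [D MD <-] [E ME <-]; rewrite -lift_lin !phiK //.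
  exact: Mlin.
- move=> _ _ [D MD <-] [E ME <-]; rewrite -lift_lie // !phiK //.
  exact: Mlie.
- by move=> _ _ [D MD <-] [E ME <-]; rewrite !phiK // => ->.
move=> E; split=> [ME|[_ [D MD <-] <-]]; last by rewrite phiK.
by exists (lift alpha E); [exists E | rewrite phiK].
Qed.

Lemma algebraic_jacobian (K : fieldType) (M : Vec K -> Prop) :
    has_char0 K -> affine_algebra M -> all_algebraic M ->
  jacobian_conjecture2 K.
Proof.
move=> charK0 affM algM alpha et_a.
have algL := algM _ (lift_of_type charK0 affM et_a).
have [Mx My Mh _ _] := affine_algebra_generators affM.
have cross0 := lift_unit_cross et_a.
have nil D a : M D -> lift alpha D != 0 -> a != 0 -> lie (polX K, - polY K) D = a *: D ->
    forall p, exists k, iter k (vapp (lift alpha D)) p = 0.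
  move=> MD D0 a0 hD; apply: (locally_nilpotent charK0 algL _ _ D0 a0).
  - by exists (polX K, - polY K).
  - by exists D.
  by rewrite -lift_lie // hD liftZ.
apply: bijective_choice; first exact: etale_inj.
apply: (etale_surj charK0 et_a).
- apply: (nil _ (-1)) => //; last exact: lie_weight_x.
    by apply: contraNneq cross0 => ->; rewrite /cross /= !mul0r subrr.
  by rewrite oppr_eq0 oner_eq0.
apply: (nil _ 1) => //; [|exact: oner_neq0 | exact: lie_weight_y].
by apply: contraNneq cross0 => ->; rewrite /cross /= !mulr0 subrr.
Qed.

(** For a bijective alpha the lift is conjugation by alpha, so alpha' composed with
    the inverse of alpha carries one algebra to the other. *)
Lemma jacobian_conjugate (K : fieldType) (M : Vec K -> Prop) :
    has_char0 K -> affine_algebra M -> jacobian_conjecture2 K ->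
  all_conjugate M.
Proof.
move=> charK0 affM JC L L' typeL typeL'.
have [alpha et_a LE] := affine_type_lift charK0 affM typeL.
have [alpha' et_a' LE'] := affine_type_lift charK0 affM typeL'.
have [b aK bK] := JC alpha et_a; have [b' aK' bK'] := JC alpha' et_a'.
have [beta bE] := lrmorphism_inverse aK bK.
exists (alpha' \o beta : {lrmorphism Pxy K -> Pxy K}), (alpha \o b').
have conj D f : alpha' (beta (vapp (lift alpha D) (alpha (b' f)))) = vapp (lift alpha' D) f.
  by rewrite vapp_lift // bE aK -vapp_lift // bK'.
split=> [f|f|E] /=; first by rewrite bE aK' bK.
  by rewrite bE aK bK'.
split=> [/LE'[D MD <-]|[_ /LE[D MD <-] ED]].
  by exists (lift alpha D); [apply/LE; exists D | move=> f; rewrite conj].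
by apply/LE'; exists D => //; apply: eq_field => f; rewrite ED conj.
Qed.

Lemma conjugate_algebraic (K : fieldType) (M L : Vec K -> Prop) :
  conjugate M L -> algebraic M -> algebraic L.
Proof.
case=> [alpha [b [aK bK LE]]] algM.
have [beta bE] := lrmorphism_inverse aK bK.
have {}aK : cancel alpha beta by move=> f; rewrite bE.
have {}bK : cancel beta alpha by move=> f; rewrite bE.
pose push D : Vec K := (alpha (vapp D (beta (polX K))), alpha (vapp D (beta (polY K)))).
have pushE D f : vapp (push D) f = alpha (vapp D (beta f)).
  have [E DE] := conjugate_field D aK bK.
  have -> : push D = E.
    by rewrite /push -!DE vapp_polX vapp_polY -surjective_pairing.
  exact: DE.
have push_lin a D E : push (a *: D + E) = a *: push D + push E.
  by apply: eq_field => f; rewrite !(vapp_linearl, pushE) linearP.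
have push_lie D E : push (lie D E) = lie (push D) (push E).
  by apply: eq_field => f; rewrite !(lieE, pushE) !aK rmorphB.
have push0 : push 0 = 0.
  by have := push_lin (-1) 0 0; rewrite scaler0 addr0 scaleN1r addNr.
have push_surj D : exists D0, push D0 = D.
  have [D0 D0E] := conjugate_field D bK aK.
  by exists D0; apply: eq_field => f; rewrite pushE D0E !bK.
move=> D; have [D0 <-] := push_surj D; have [s sD0 sM] := algM D0.
have push_span F : span s F -> span (map push s) (push F).
  apply: (span_ind (P := fun F => span (map push s) (push F))).
  - by rewrite push0; apply: span0.
  - by move=> a E G sE sG; rewrite push_lin; apply: span_linear.
  by move=> E sE; apply: span_mem; apply: map_f.
exists (map push s); first exact: push_span.
move=> E F /LE[E0 ME0 EE0] sF.
have [F0 sF0 ->] : exists2 F0, span s F0 & F = push F0.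
  move: F sF; apply: (span_ind (P := fun F => exists2 F0, span s F0 & F = push F0)).
  - by exists 0; [apply: span0 | rewrite push0].
  - move=> a _ _ [G sG ->] [G' sG' ->]; exists (a *: G + G'); last by rewrite push_lin.
    exact: span_linear.
  by move=> _ /mapP[G sG ->]; exists G => //; apply: span_mem.
have -> : E = push E0 by apply: eq_field => f; rewrite EE0 pushE bE.
by rewrite -push_lie; apply: push_span; apply: sM.
Qed.

Lemma conjugate_all_algebraic (K : fieldType) (M : Vec K -> Prop) :
  has_char0 K -> affine_algebra M -> all_conjugate M -> all_algebraic M.
Proof.
move=> charK0 affM conjM L typeL.
apply: conjugate_algebraic (affine_algebra_algebraic charK0 affM).
exact: conjM (affine_algebra_type charK0 affM) typeL.
Qed.

Theorem mainTheorem1 (K : closedFieldType) (charK0 : [pchar K] =i pred0) :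
  [<-> jacobian_conjecture2 K;
       all_conjugate (@aff2 K);
       all_conjugate (@saff2 K);
       all_algebraic (@aff2 K);
       all_algebraic (@saff2 K)].
Proof.
have affA := affine_algebra_aff2 charK0; have affS := affine_algebra_saff2 charK0.
tfae.
- exact: jacobian_conjugate charK0 affA.
- move/(conjugate_all_algebraic charK0 affA)/(algebraic_jacobian charK0 affA).
  exact: jacobian_conjugate charK0 affS.
- move/(conjugate_all_algebraic charK0 affS)/(algebraic_jacobian charK0 affS).
  move/(jacobian_conjugate charK0 affA).
  exact: conjugate_all_algebraic.
- move/(algebraic_jacobian charK0 affA)/(jacobian_conjugate charK0 affS).
  exact: conjugate_all_algebraic.
- exact: algebraic_jacobian charK0 affS.
Qed.
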